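(* For the six graphs $W_1,\dots,W_6$ on $22$ vertices listed in the context, the values $A_k(W_i)$ coincide (for $i=1,\dots,6$) for all $3\le k\le 11$. The first length at which they differ is $k=12$. At length $12$, the simple-cycle contribution is still common, $$A_{12,\mathrm{cyc}}(W_i)=\tfrac{87}{2048}\qquad (i=1,\dots,6),$$ and the entire difference lies in the non-simple contribution $A_{12,\mathrm{nonsimp}}(W_i)$.
   Context: A dart of a graph $G$ is an ordered pair $(u,v)$ with $uv\in E(G)$; its tail is $u$, its head is $v$, and $\alpha(u,v)=(v,u)$. A rotation system of $G$ assigns to each vertex $v$ a cyclic ordering of its neighbours; $\sigma_v(u)$ denotes the neighbour of $v$ following $u$. A circuit of length $k$ is a cyclic sequence $C=(d_0,\dots,d_{k-1})$ of pairwise distinct darts, up to cyclic shift, in which the head of $d_i$ is the tail of $d_{i+1}$ and $d_{i+1}\neq\alpha(d_i)$ (indices mod $k$). Each pass $d_i=(u,v)$, $d_{i+1}=(v,w)$ imposes the constraint $\sigma_v(u)=w$. $\mathcal C_k(G)$ is the set of circuits of length $k$; $\chi(C)=1$ if some rotation system meets every constraint of $C$ and $\chi(C)=0$ otherwise; $r(C)$ is the number of distinct vertices visited by $C$. Put $A_k(G)=\sum_{C\in\mathcal C_k(G)}\chi(C)2^{-r(C)}$, and split $A_k=A_{k,\mathrm{cyc}}+A_{k,\mathrm{nonsimp}}$, where $A_{k,\mathrm{cyc}}$ is the sum over vertex-simple $C$ (no repeated vertex) and $A_{k,\mathrm{nonsimp}}$ the sum over the remaining $C$. The six cubic graphs,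 on vertex set $\{0,\dots,21\}$ (edges written $i$-$j$): $W_1$: 0-1, 0-2, 0-3, 1-16, 1-21, 2-17, 2-19, 3-18, 3-20, 4-12, 4-13, 4-15, 5-8, 5-9, 5-13, 6-7, 6-9, 6-12, 7-8, 7-11, 8-11, 9-10, 10-14, 10-16, 11-16, 12-18, 13-17, 14-17, 14-18, 15-19, 15-20, 19-21, 20-21. $W_2$: 0-1, 0-2, 0-3, 1-16, 1-19, 2-17, 2-18, 3-20, 3-21, 4-5, 4-6, 4-9, 5-14, 5-15, 6-7, 6-8, 7-10, 7-12, 8-11, 8-13, 9-10, 9-11, 10-19, 11-19, 12-16, 12-18, 13-16, 13-17, 14-18, 14-21, 15-17, 15-20, 20-21. $W_3$: 0-1, 0-2, 0-3, 1-16, 1-21, 2-17, 2-18, 3-19, 3-20, 4-5, 4-6, 4-7, 5-14, 5-15, 6-12, 6-13, 7-8, 7-9, 8-9, 8-10, 9-11, 10-12, 10-16, 11-13, 11-16, 12-18, 13-17, 14-18, 14-20, 15-17, 15-19, 19-21, 20-21. $W_4$: 0-1, 0-2, 0-3, 1-18, 1-19, 2-3, 2-21, 3-20, 4-7, 4-16, 4-21, 5-8, 5-12, 5-17, 6-13, 6-14, 6-17, 7-11, 7-20, 8-9, 8-16, 9-10, 9-11, 10-14, 10-15, 11-13, 12-13, 12-14, 15-19, 15-20, 16-19, 17-18, 18-21. $W_5$: 0-1, 0-2, 0-3, 1-16, 1-21, 2-17, 2-18, 3-19, 3-20, 4-5, 4-6, 4-7, 5-14, 5-15, 6-8, 6-12,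 7-9, 7-13, 8-9, 8-11, 9-11, 10-12, 10-13, 10-16, 11-16, 12-18, 13-17, 14-18, 14-20, 15-17, 15-19, 19-21, 20-21. $W_6$: 0-1, 0-2, 0-3, 1-16, 1-19, 2-17, 2-20, 3-18, 3-21, 4-5, 4-14, 4-15, 5-6, 5-9, 6-7, 6-8, 7-11, 7-13, 8-10, 8-12, 9-10, 9-11, 10-19, 11-19, 12-16, 12-18, 13-16, 13-17, 14-17, 14-18, 15-20, 15-21, 20-21. *)

(* Defs.v *)
From mathcomp Require Import all_boot all_order all_algebra perm.

Set Implicit Arguments.
Unset Strict Implicit.
Unset Printing Implicit Defensive.

Import GRing.Theory.
Local Open Scope ring_scope.

Record sgraph (T : finType) := SGraph {
  adj :> rel T;
  adj_sym : symmetric adj;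
  adj_irr : irreflexive adj }.

Section Circuits.

Variables (T : finType) (G : sgraph T).

Definition is_dart (d : T * T) : bool := G d.1 d.2.

Definition alpha (d : T * T) : T * T := (d.2, d.1).

Definition nbrs (v : T) : {set T} := [set u | G v u].

(* A cyclic ordering of the neighbours of v is given by its successor map
   sigma_v, a permutation of N(v) consisting of a single cycle; it is extended
   to the other vertices by the identity, which makes it unique. *)
Definition is_rotation_system (sigma : {ffun T -> {perm T}}) : bool :=
  [forall v, perm_on (nbrs v) (sigma v) &&
    [forall u in nbrs v, porbit (sigma v) u == nbrs v]].

Definition follows (d d' : T * T) : bool := (d.2 == d'.1) && (d' != alpha d).

(* [cycle] compares cyclically consecutive items, the last one being followed
   by the first. *)
Definition is_circuit (k : nat) (t : k.-tuple (T * T)) : bool :=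
  [&& all is_dart t, uniq t & cycle follows t].

Definition shifts (k : nat) (t : k.-tuple (T * T)) : {set k.-tuple (T * T)} :=
  [set [tuple of rot j t] | j : 'I_k.+1].

(* A circuit is a cyclic sequence, that is, the set of all cyclic shifts of a
   sequence of darts.  A circuit and its reversal are distinct. *)
Definition circuits (k : nat) : {set {set k.-tuple (T * T)}} :=
  [set shifts t | t : k.-tuple (T * T) & is_circuit t].

(* The pass d = (u, v), d' = (v, w) imposes sigma_v(u) = w. *)
Definition meets (sigma : {ffun T -> {perm T}}) (s : seq (T * T)) : bool :=
  cycle (fun d d' => sigma d.2 d.1 == d'.2) s.

(* All the data below are invariant under cyclic shift, so that quantifying
   over the sequences t in C amounts to choosing any one of them. *)
Definition chi (k : nat) (C : {set k.-tuple (T * T)}) : bool :=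
  [exists sigma : {ffun T -> {perm T}},
    is_rotation_system sigma && [forall t in C, meets sigma t]].

Definition visited (k : nat) (C : {set k.-tuple (T * T)}) : {set T} :=
  [set v | [exists t in C, v \in [seq d.1 | d <- tval t]]].

Definition r (k : nat) (C : {set k.-tuple (T * T)}) : nat := #|visited C|.

Definition vertex_simple (k : nat) (C : {set k.-tuple (T * T)}) : bool :=
  [forall t in C, uniq [seq d.1 | d <- tval t]].

Definition weight (k : nat) (C : {set k.-tuple (T * T)}) : rat :=
  (chi C)%:R * 2 ^- r C.

Definition A (k : nat) : rat := \sum_(C in circuits k) weight C.

Definition A_cyc (k : nat) : rat :=
  \sum_(C in circuits k | vertex_simple C) weight C.

Definition A_nonsimp (k : nat) : rat :=
  \sum_(C in circuits k | ~~ vertex_simple C) weight C.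

Lemma A_split (k : nat) : A k = A_cyc k + A_nonsimp k.
Proof. exact: bigID. Qed.

End Circuits.

Definition W1_edges : seq (nat * nat) :=
  [:: (0, 1); (0, 2); (0, 3); (1, 16); (1, 21); (2, 17); (2, 19); (3, 18);
      (3, 20); (4, 12); (4, 13); (4, 15); (5, 8); (5, 9); (5, 13); (6, 7);
      (6, 9); (6, 12); (7, 8); (7, 11); (8, 11); (9, 10); (10, 14); (10, 16);
      (11, 16); (12, 18); (13, 17); (14, 17); (14, 18); (15, 19); (15, 20); (19, 21);
      (20, 21)].

Definition W2_edges : seq (nat * nat) :=
  [:: (0, 1); (0, 2); (0, 3); (1, 16); (1, 19); (2, 17); (2, 18); (3, 20);
      (3, 21); (4, 5); (4, 6); (4, 9); (5, 14); (5, 15); (6, 7); (6, 8);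
      (7, 10); (7, 12); (8, 11); (8, 13); (9, 10); (9, 11); (10, 19); (11, 19);
      (12, 16); (12, 18); (13, 16); (13, 17); (14, 18); (14, 21); (15, 17); (15, 20);
      (20, 21)].

Definition W3_edges : seq (nat * nat) :=
  [:: (0, 1); (0, 2); (0, 3); (1, 16); (1, 21); (2, 17); (2, 18); (3, 19);
      (3, 20); (4, 5); (4, 6); (4, 7); (5, 14); (5, 15); (6, 12); (6, 13);
      (7, 8); (7, 9); (8, 9); (8, 10); (9, 11); (10, 12); (10, 16); (11, 13);
      (11, 16); (12, 18); (13, 17); (14, 18); (14, 20); (15, 17); (15, 19); (19, 21);
      (20, 21)].

Definition W4_edges : seq (nat * nat) :=
  [:: (0, 1); (0, 2); (0, 3); (1, 18); (1, 19); (2, 3); (2, 21); (3, 20);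
      (4, 7); (4, 16); (4, 21); (5, 8); (5, 12); (5, 17); (6, 13); (6, 14);
      (6, 17); (7, 11); (7, 20); (8, 9); (8, 16); (9, 10); (9, 11); (10, 14);
      (10, 15); (11, 13); (12, 13); (12, 14); (15, 19); (15, 20); (16, 19); (17, 18);
      (18, 21)].

Definition W5_edges : seq (nat * nat) :=
  [:: (0, 1); (0, 2); (0, 3); (1, 16); (1, 21); (2, 17); (2, 18); (3, 19);
      (3, 20); (4, 5); (4, 6); (4, 7); (5, 14); (5, 15); (6, 8); (6, 12);
      (7, 9); (7, 13); (8, 9); (8, 11); (9, 11); (10, 12); (10, 13); (10, 16);
      (11, 16); (12, 18); (13, 17); (14, 18); (14, 20); (15, 17); (15, 19); (19, 21);
      (20, 21)].

Definition W6_edges : seq (nat * nat) :=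
  [:: (0, 1); (0, 2); (0, 3); (1, 16); (1, 19); (2, 17); (2, 20); (3, 18);
      (3, 21); (4, 5); (4, 14); (4, 15); (5, 6); (5, 9); (6, 7); (6, 8);
      (7, 11); (7, 13); (8, 10); (8, 12); (9, 10); (9, 11); (10, 19); (11, 19);
      (12, 16); (12, 18); (13, 16); (13, 17); (14, 17); (14, 18); (15, 20); (15, 21);
      (20, 21)].

(* The index i : 'I_6 stands for the graph W_(i+1). *)
Definition W_edges (i : 'I_6) : seq (nat * nat) :=
  nth [::] [:: W1_edges; W2_edges; W3_edges; W4_edges; W5_edges; W6_edges] i.

Definition W_adj (i : 'I_6) : rel 'I_22 := fun u v =>
  ((val u, val v) \in W_edges i) || ((val v, val u) \in W_edges i).

Lemma W_adj_sym (i : 'I_6) : symmetric (W_adj i).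
Proof. by move=> u v; rewrite /W_adj orbC. Qed.

Lemma W_adj_irr (i : 'I_6) : irreflexive (W_adj i).
Proof.
have E : all (fun e => e.1 != e.2) (W_edges i).
  by case: i => [[|[|[|[|[|[|]]]]]]].
move=> u; rewrite /W_adj orbb; apply/negbTE/negP => /(allP E).
by rewrite eqxx.
Qed.

Definition W (i : 'I_6) : sgraph 'I_22 := SGraph (@W_adj_sym i) (@W_adj_irr i).

Lemma W_cubic (i : 'I_6) (v : 'I_22) : #|nbrs (W i) v| = 3%N.
Proof.
pose b (j v : nat) (u : nat) := let E := nth [::]
  [:: W1_edges; W2_edges; W3_edges; W4_edges; W5_edges; W6_edges] j in
  ((v, u) \in E) || ((u, v) \in E).
have Hall : all (fun j => all (fun v => count (b j v) (iota 0 22) == 3%N)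
  (iota 0 22)) (iota 0 6) by vm_compute.
have Hi : val i \in iota 0 6 by rewrite mem_iota ltn_ord.
have Hv : val v \in iota 0 22 by rewrite mem_iota ltn_ord.
have /eqP H := allP (allP Hall _ Hi) _ Hv; apply: etrans _ H.
rewrite -(val_enum_ord 22) count_map enumT cardE /enum_mem size_filter.
by apply: eq_count => u; rewrite /= inE.
Qed.

(* Main.v *)
Require Import Defs.
From mathcomp Require Import all_boot all_order all_algebra perm.

(** A cubic graph has exactly two cyclic orderings at each vertex, inverse to
    each other, so a rotation system amounts to one bit per vertex.  Once the
    bits [b] are chosen, the constraints of a circuit say that each dart is sent
    to the next one by the permutation [face_step b] of the darts: a circuit
    satisfiable by [b] is a face of the embedding that [b] describes.

    A satisfiable circuit forces the bit of every vertex that it visits and of no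
    other, so it is a face for a proportion [2 ^ - r] of the choices of [b]
    ([weight_shifts]).  Hence [A k] is the expected number of faces of length
    [k] for uniformly random bits, and [A_cyc k] is the expected number of those
    faces that repeat no vertex.  Each face is counted once by starting it at its
    least dart ([sum_weights]).

    That expectation is computed by following a face from its starting dart while
    revealing the bits only when a vertex is first met: a new vertex opens two
    branches, a known vertex leaves a single continuation.  Giving the latter the
    weight 2 makes the total over all branches equal to [2 ^ k] times the
    expectation, an integer ([search_correct], [count_faces_correct]).

    Running this search gives the same integers for the six graphs up to length
    11; at length 12 it gives 270 for the first graph and 302 for the second, and
    174 vertex-simple faces for each of the six, that is [174 / 2 ^ 12 = 87 / 2048].
    As the vertex-simple parts agree, differences of [A] at length 12 are
    differences of the non-simple parts. *)

Set Implicit Arguments.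
Unset Strict Implicit.
Unset Printing Implicit Defensive.

Import GRing.Theory Num.Theory.

(** * Rotations at a vertex of degree three *)

Lemma next_prev3 (S : eqType) (l : seq S) (u : S) :
  uniq l -> size l = 3 -> u \in l ->
  [/\ l =i [:: u; next l u; prev l u], uniq [:: u; next l u; prev l u],
      next l (next l u) = prev l u & prev l (prev l u) = next l u].
Proof.
case: l => [|x [|y [|z []]]] //=; rewrite !inE !andbT negb_or.
case/andP=> /andP[xy xz] yz _.
have [yx zx zy] : [/\ y != x, z != x & z != y].
  by rewrite ![_ == x]eq_sym (eq_sym z y).
pose ne := (negbTE xy, negbTE yx, negbTE yz, negbTE zy, negbTE xz, negbTE zx, eqxx).
by case/or3P=> /eqP->; do 3 rewrite ?ne; split=> // w; rewrite !inE;
  case: (w == x); case: (w == y); case: (w == z).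
Qed.

Section CubicRotations.

Variables (T : finType) (G : sgraph T).
Hypothesis cubic : forall v, #|nbrs G v| = 3.

(** The two cyclic orderings of the neighbours of [v]: the listing of the
    neighbours read forwards or backwards.  Vertices that are not neighbours of
    [v] are fixed, which makes each ordering a permutation of [T]. *)
Definition turn (c : bool) (v : T) : T -> T :=
  (if c then next else prev) (enum (nbrs G v)).

Lemma turnK c v : cancel (turn c v) (turn (~~ c) v).
Proof.
by case: c => u /=; rewrite /turn ?prev_next ?next_prev ?enum_uniq.
Qed.

Lemma turnP c v u : G v u ->
  [/\ nbrs G v =i [:: u; turn c v u; turn (~~ c) v u],
      uniq [:: u; turn c v u; turn (~~ c) v u]
    & turn c v (turn c v u) = turn (~~ c) v u].
Proof.
move=> vu.
have [] := @next_prev3 _ (enum (nbrs G v)) u (enum_uniq _).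
- by rewrite -cardE.
- by rewrite mem_enum inE.
move=> E U nn pp; rewrite /turn; case: c => /=.
  by split=> // w; rewrite -E mem_enum.
split=> // [w|]; first by rewrite -mem_enum E !inE (orbC (w == next _ _)).
by move: U; rewrite /= !inE !andbT !negb_or => /andP[/andP[-> ->]]; rewrite eq_sym.
Qed.

Lemma turn_adj c v u : G v u -> G v (turn c v u).
Proof.
by case/(@turnP c) => /(_ (turn c v u)) + _ _; rewrite !inE eqxx orbT.
Qed.

Lemma turn_neq c v u : G v u -> turn c v u != u.
Proof.
case/(@turnP c) => _ + _; rewrite /= !inE negb_or => /andP[/andP[+ _] _].
by rewrite eq_sym.
Qed.

Lemma turn_inj v u : G v u -> injective (fun c => turn c v u).
Proof.
move=> vu c c' /= E; apply/eqP; apply: contraT => ne.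
have {ne} Ec : c' = ~~ c by case: c c' ne {E} => [] [].
case/(@turnP c): vu => _ + _.
by rewrite /= !inE E Ec eqxx andbF.
Qed.

Lemma adj_turn v u w : G v u -> G v w -> w != u -> exists c, w = turn c v u.
Proof.
move=> /(@turnP true)[+ _ _] vw; move/(_ w); rewrite !inE vw.
case: eqP => //= _ /esym/orP[]/eqP ->; first by exists true.
by exists false.
Qed.

Definition spin (b : {ffun T -> bool}) : {ffun T -> {perm T}} :=
  [ffun v => perm (can_inj (@turnK (b v) v))].

Lemma spinE b v u : spin b v u = turn (b v) v u.
Proof. by rewrite ffunE permE. Qed.

Lemma turn_id c v u : ~~ G v u -> turn c v u = u.
Proof.
move=> vu; have {vu} : u \notin enum (nbrs G v) by rewrite mem_enum inE.
by rewrite /turn; case: c => Nu; rewrite ?next_nth ?prev_nth (negbTE Nu).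
Qed.

Lemma spin_rotation b : is_rotation_system G (spin b).
Proof.
apply/forallP => v; apply/andP; split.
  by apply/subsetP => u; rewrite inE spinE inE; apply: contraR => /turn_id ->.
apply/forall_inP => u; rewrite inE => vu; apply/eqP/setP => w.
apply/idP/idP.
  case/porbitP => i ->; rewrite permX.
  elim: i => [|i IH] /=; first by rewrite inE.
  by rewrite spinE inE turn_adj // -(in_set (fun w => G v w)).
have [-> _ tt] := turnP (b v) vu; rewrite !inE; case/or3P=> /eqP ->.
- exact: porbit_id.
- by rewrite -spinE; have := mem_porbit (spin b v) 1 u; rewrite expg1.
- by rewrite -tt -!spinE; have := mem_porbit (spin b v) 2 u; rewrite permX.
Qed.

(** The permutation [sigma v] fixes no neighbour of [v], so it sends a neighbour
    [u0] to one of its two turns [u1].  It cannot then send [u1] back to [u0],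
    for the orbit of [u0] would miss the third neighbour [u2]; so it agrees with
    the same turn everywhere. *)
Lemma rotation_turn sigma v : is_rotation_system G sigma ->
  exists c, forall u, G v u -> sigma v u = turn c v u.
Proof.
move/forallP/(_ v)/andP => [_ /forall_inP orb].
have orbE u w : G v u -> G v w -> exists i, w = iter i (sigma v) u.
  move=> vu vw; have /orb/eqP/setP/(_ w) : u \in nbrs G v by rewrite inE.
  by rewrite [RHS]inE vw => /porbitP[i ->]; exists i; rewrite permX.
have sadj u : G v u -> G v (sigma v u).
  move=> vu; have /orb/eqP/setP/(_ (sigma v u)) : u \in nbrs G v by rewrite inE.
  by rewrite inE => <-; have := mem_porbit (sigma v) 1 u; rewrite expg1.
have sneq u : G v u -> sigma v u != u.
  move=> vu; apply/eqP => fix_u.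
  have [i E] := orbE _ _ vu (turn_adj true vu).
  by have := turn_neq true vu; rewrite E iter_fix ?eqxx.
have [u0] : exists u, u \in nbrs G v by apply/card_gt0P; rewrite cubic.
rewrite inE => vu0.
have [c s0] := adj_turn vu0 (sadj _ vu0) (sneq _ vu0).
exists c => u vu.
have [_ U tt] := turnP c vu0.
set u1 := turn c v u0 in s0 U tt *; set u2 := turn (~~ c) v u0 in U tt *.
have vu1 : G v u1 by apply: turn_adj.
have vu2 : G v u2 by apply: turn_adj.
have tt2 : turn c v u2 = u0 by have := turnK (~~ c) v u0; rewrite negbK.
have s1 : sigma v u1 = u2.
  have [c' s1] := adj_turn vu1 (sadj _ vu1) (sneq _ vu1).
  case: (eqVneq c' c) s1 => [-> -> // | ne s1].
  have Ec : c' = ~~ c by case: c c' ne {s0 U tt tt2 s1 vu1 vu2 u1 u2} => [] [].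
  have {}s1 : sigma v u1 = u0 by rewrite s1 Ec turnK.
  have [i] := orbE _ _ vu0 vu2.
  have : iter i (sigma v) u0 \in [:: u0; u1].
    by elim: i => [|i]; rewrite /= !inE ?eqxx // => /orP[]/eqP->;
       rewrite ?s0 ?s1 eqxx ?orbT.
  move=> + E; rewrite -E => {E}; move: U; rewrite /= !inE negb_or.
  by case/and3P=> [/andP[_ /negbTE]]; rewrite eq_sym => -> /negbTE;
     rewrite eq_sym => ->.
have s2 : sigma v u2 = u0.
  have := sneq _ vu2; have := sadj _ vu2.
  have [/(_ (sigma v u2)) + _ _] := turnP c vu0.
  rewrite !inE => -> /or3P[] /eqP // E; last by rewrite E eqxx.
  move: E; rewrite -/u1 -s0 => /perm_inj E; move: U.
  by rewrite /= !inE E eqxx orbT.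
have [/(_ u) + _ _] := turnP c vu0.
rewrite !inE vu => /esym/or3P[]/eqP->; first by rewrite s0.
  by rewrite s1 -tt.
by rewrite s2 tt2.
Qed.

Lemma rotation_spin sigma : is_rotation_system G sigma ->
  exists b : {ffun T -> bool}, forall v u, G v u -> sigma v u = turn (b v) v u.
Proof.
move=> rot.
exists [ffun v => [forall u, G v u ==> (sigma v u == turn true v u)]] => v u vu.
rewrite ffunE; have [c cE] := rotation_turn v rot.
suff -> : [forall u, G v u ==> (sigma v u == turn true v u)] = c by apply: cE.
apply/forallP/idP => [/(_ u)|ct w].
  by rewrite vu cE // => /eqP/(turn_inj vu) ->.
by apply/implyP => vw; rewrite cE // ct.
Qed.

(** * Circuits as faces *)

Definition face_step (b : {ffun T -> bool}) (d : T * T) : T * T :=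
  (d.2, turn (b d.2) d.2 d.1).

Lemma face_step_inj b : injective (face_step b).
Proof. by case=> u v [u' v'] [-> /(can_inj (@turnK _ _)) /= ->]. Qed.

Lemma face_step_dart b d : is_dart G d -> is_dart G (face_step b d).
Proof. by rewrite /is_dart /= adj_sym => /turn_adj. Qed.

Lemma face_step_follows b d : is_dart G d -> follows d (face_step b d).
Proof.
rewrite /is_dart adj_sym /follows /= eqxx => /turn_neq ne.
by rewrite /face_step /alpha xpair_eqE eqxx ne.
Qed.

(** Along a circuit [d'.1 = d.2] already holds, so the constraint of a pass fixes
    only the head of the next dart, and [face_step] encodes exactly that; the
    constraints look at [sigma v] on neighbours of [v] alone, where every rotation
    system is some [spin b]. *)
Lemma chi_shifts k (t : k.-tuple (T * T)) : is_circuit G t ->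
  chi G (shifts t) = [exists b, fcycle (face_step b) t].
Proof.
case/and3P=> /allP darts _ fol.
have meetsE b : meets (spin b) t = fcycle (face_step b) t.
  have : cycle [rel d d' | follows d d' && (spin b d.2 d.1 == d'.2)] t
       = cycle [rel d d' | follows d d' && (face_step b d == d')] t.
    apply: eq_cycle => [[u v]] [v' w]; rewrite /follows /face_step /= spinE !xpair_eqE.
    by case: (eqVneq v v') => //= ->.
  rewrite (cycle_relI (@follows T) (fun d d' => spin b d.2 d.1 == d'.2)).
  by rewrite (cycle_relI (@follows T) (fun d d' => face_step b d == d')) fol.
have meets_rot sigma j : meets sigma (rot j t) = meets sigma t by exact: rot_cycle.
have shift_meets sigma :
    [forall t' in shifts t, meets sigma t'] = meets sigma t.
  apply/forall_inP/idP => [/(_ t) -> //|mt t' /imsetP[j _ ->]] /=.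
    by apply/imsetP; exists ord0 => //; apply: val_inj; rewrite /= rot0.
  by rewrite meets_rot.
apply/existsP/existsP => [[sigma]|[b bt]]; last first.
  by exists (spin b); rewrite spin_rotation shift_meets meetsE.
rewrite shift_meets => /andP[/rotation_spin[b sb] mt]; exists b.
rewrite -meetsE; apply: etrans mt.
apply: (@eq_in_cycle _ (mem (tval t))); last exact/allP.
by move=> d d' /darts; rewrite /is_dart adj_sym => dd _ /=; rewrite spinE sb.
Qed.

(** The total assignments of bits that agree with the partial one [p]. *)
Definition extensions (p : T -> option bool) : {set {ffun T -> bool}} :=
  [set b : {ffun T -> bool} | [forall v, (p v == None) || (p v == Some (b v))]].

Lemma card_extensions p : #|extensions p| = 2 ^ #|[set v | p v == None]|.
Proof.
pose F v := [pred c | (p v == None) || (p v == Some c)].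
have -> : #|extensions p| = #|family F|.
  by rewrite cardsE; apply: eq_card => b; rewrite !inE; apply/forallP/familyP => H v;
    have := H v; rewrite inE.
have -> : #|family F| = \prod_v #|F v|.
  rewrite card_family /image_mem -big_enum /=.
  by elim: (enum T) => [|v s /= ->]; rewrite ?big_nil ?big_cons.
rewrite -sum1dep_card expn_sum [RHS]big_mkcond /=; apply: eq_bigr => v _.
case E: (p v) => [c|] /=.
  by rewrite -(card1 c); apply: eq_card => c'; rewrite !inE E /= eq_sym.
by rewrite -card_bool; apply: eq_card => c; rewrite inE E.
Qed.

Lemma visited_shifts k (t : k.-tuple (T * T)) :
  visited (shifts t) = [set v in [seq d.1 | d <- tval t]].
Proof.
apply/setP => v; rewrite !inE; apply/existsP/idP => [[t' /andP[]]|vt].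
  by case/imsetP=> j _ -> /=; rewrite map_rot mem_rot.
exists t; rewrite vt andbT; apply/imsetP; exists ord0 => //.
by apply: val_inj; rewrite /= rot0.
Qed.

Lemma vertex_simple_shifts k (t : k.-tuple (T * T)) :
  vertex_simple (shifts t) = uniq [seq d.1 | d <- tval t].
Proof.
apply/forall_inP/idP => [/(_ t)|ut t' /imsetP[j _ ->] /=].
  by apply; apply/imsetP; exists ord0 => //; apply: val_inj; rewrite /= rot0.
by rewrite map_rot rot_uniq.
Qed.

Lemma fcycle_heads b (t : seq (T * T)) : fcycle (face_step b) t ->
  [seq d.1 | d <- rot 1 t] = [seq d.2 | d <- t].
Proof.
case: t => // d t; rewrite rot1_cons /=; move: (d in rcons _ d) => e.
elim: t d => [|d' t IH] d /=; first by rewrite andbT => /eqP <-.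
by case/andP=> /eqP <- /IH ->.
Qed.

(** If some [b0] makes the circuit [t] a face, then the others that do are those
    that agree with [b0] at the visited vertices: the two turns at a vertex differ
    on each neighbour, so a single pass through [v] forces the bit of [v]. *)
Lemma weight_shifts k (t : k.-tuple (T * T)) : is_circuit G t ->
  (weight G (shifts t) * 2 ^+ #|T|
   = #|[set b | fcycle (face_step b) t]|%:R)%R.
Proof.
move=> ct; rewrite /weight chi_shifts //; case/and3P: ct => /allP darts _ fol.
case: existsP => [[b0 bt0]|no]; last first.
  rewrite !mul0r (_ : [set b | _] = set0) ?cards0 //.
  by apply/setP => b; rewrite !inE; apply/negP => bt; case: no; exists b.
pose V := [set v in [seq d.1 | d <- tval t]].
have VE v : (v \in V) = (v \in [seq d.2 | d <- tval t]).
  by rewrite -(fcycle_heads bt0) map_rot mem_rot inE.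
have -> : [set b | fcycle (face_step b) t]
    = extensions (fun v => if v \in V then Some (b0 v) else None).
  apply/setP => b; rewrite !inE.
  have turn_mem d : d \in tval t -> G d.2 d.1.
    by move=> /darts; rewrite /is_dart adj_sym.
  apply/idP/forallP => [bt v|agree].
    case: ifP => //; rewrite VE => /mapP[d dt ->]; apply/eqP; congr Some.
    have /eqP := next_cycle bt dt; have /eqP <- := next_cycle bt0 dt.
    by case=> /(turn_inj (turn_mem _ dt)).
  apply: etrans bt0; apply: (@eq_in_cycle _ (mem (tval t))); last exact/allP.
  move=> d d' dt _; rewrite /= /face_step.
  by have := agree d.2; rewrite VE map_f //= => /eqP[->].
rewrite card_extensions mul1r /r visited_shifts -/V.
have -> : [set v | (if v \in V then Some (b0 v) else None) == None] = ~: V.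
  by apply/setP => v; rewrite !inE; case: ifP.
rewrite -(cardsC V) exprD mulrA mulVf ?expf_neq0 ?pnatr_eq0 // mul1r.
by rewrite natrX.
Qed.

(** * Counting each face from its least dart *)

(** Any total order on the darts will do to single out one dart of each circuit;
    it is given here by an injective numbering. *)
Variable key : T * T -> nat.
Hypothesis key_inj : injective key.

(** For [d = d0] this says that [d0] is the least dart of a face of length
    [n.+1]; the separate argument [d] lets the walk be followed step by step. *)
Definition closes (b : {ffun T -> bool}) (d0 : T * T) (n : nat) (d : T * T) :=
  all (fun e => key d0 < key e) (traject (face_step b) (face_step b d) n)
  && (iter n.+1 (face_step b) d == d0).

Definition heads b n (d : T * T) := [seq e.2 | e <- traject (face_step b) d n].

Definition least_first (t : seq (T * T)) : bool :=
  if t is d :: t' then all (fun e => key d < key e) t' else false.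

Lemma least_first_rot (t : seq (T * T)) : uniq t -> 0 < size t ->
  exists j, least_first (rot j t).
Proof.
move=> ut st; have [d0 d0t] : exists d, d \in t.
  by case: t st {ut} => // d t _; exists d; rewrite mem_head.
case: (@arg_minnP _ d0 (mem t) key d0t) => d /= dt dmin.
have [j t' E] := rot_to dt; exists j; rewrite E /=.
have := rot_uniq j t; rewrite ut E => /= /andP[dN _].
apply/allP => e et'; rewrite ltn_neqAle dmin; last first.
  by rewrite -(mem_rot j) E inE et' orbT.
by rewrite andbT; apply: contraNneq dN => /key_inj ->.
Qed.

(** Both sequences list the same darts, so both begin with the least one; as
    darts do not repeat, only the trivial rotation keeps it in place. *)
Lemma least_first_inj (t t' : seq (T * T)) j : least_first t -> least_first t' ->
  uniq t -> t' = rot j t -> t' = t.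
Proof.
case: t t' => [|d t] [|d' t'] //= td td' ut E.
have memE : d :: t =i d' :: t' by move=> e; rewrite E mem_rot.
have E0 : d = d'.
  apply: contraTeq isT => ne.
  have : d \in t' by have := memE d; rewrite mem_head inE (negbTE ne).
  have : d' \in t by have := memE d'; rewrite mem_head inE eq_sym (negbTE ne).
  by move=> /(allP td) lt /(allP td'); rewrite ltnNge ltnW.
move: E; rewrite -{}E0 {memE}; case: (leqP (size t).+1 j) => [jt|jt] E.
  by rewrite E rot_oversize.
have : nth d (rot j (d :: t)) 0 = nth d (d :: t) 0 by rewrite -E.
rewrite nth_cat size_drop /= subn_gt0 jt nth_drop addn0 => /eqP.
by rewrite (@nth_uniq _ d (d :: t) j 0 jt) // => /eqP j0; rewrite E j0 rot0.
Qed.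

Definition rooted_circuits k : {set k.-tuple (T * T)} :=
  [set t | is_circuit G t & least_first t].

Lemma shiftsP k (t t' : k.-tuple (T * T)) :
  reflect (exists j, tval t' = rot j t) (t' \in shifts t).
Proof.
apply: (iffP imsetP) => [[j _ ->]|[j E]]; first by exists j.
have jk : minn j k < k.+1 by rewrite ltnS geq_minr.
by exists (Ordinal jk) => //; apply: val_inj; rewrite /= E rot_minn size_tuple.
Qed.

Lemma shifts_eq k (t t' : k.-tuple (T * T)) : t' \in shifts t -> shifts t' = shifts t.
Proof.
move=> t't; apply/setP => u; case/shiftsP: t't => j E.
apply/shiftsP/shiftsP => [[i ->]|[i ->]].
  by exists (rot_add t j i); rewrite E rot_rot_add.
exists (rot_add t' (size t' - j) i); rewrite -rot_rot_add.
by rewrite E size_rot; have := rotK j t; rewrite /rotr size_rot => ->.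
Qed.

Lemma circuits_rooted k : circuits G k.+1 = [set shifts t | t in rooted_circuits k.+1].
Proof.
apply/setP => C; apply/imsetP/imsetP => [[t]|[t]]; rewrite inE; last first.
  by case/andP=> ct _ ->; exists t; rewrite ?inE.
move=> ct ->; case/and3P: (ct) => dt ut ft.
have [|j lt] := @least_first_rot t ut; first by rewrite size_tuple.
exists [tuple of rot j t].
  rewrite inE lt andbT /is_circuit /= (eq_all_r (mem_rot j t)).
  by rewrite rot_uniq rot_cycle dt ut ft.
by apply/esym/shifts_eq/shiftsP; exists j.
Qed.

Lemma shifts_inj k : {in rooted_circuits k &, injective (@shifts T k)}.
Proof.
move=> t t'; rewrite !inE => /andP[/and3P[_ ut _] lt] /andP[_ lt'] E.
have : t' \in shifts t by rewrite E; apply/shiftsP; exists 0; rewrite rot0.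
by case/shiftsP => j E'; apply/esym/val_inj/(least_first_inj lt lt' ut E').
Qed.

(** A face is the trajectory of its first dart.  Conversely, a trajectory that
    closes up is automatically a circuit: a turn never goes back along the same
    edge, and a repeated dart would, [face_step b] being injective, bring the walk
    back to its first dart too early. *)
Lemma rooted_faceP b n (t : n.+1.-tuple (T * T)) :
  (t \in rooted_circuits n.+1) && fcycle (face_step b) t
  = [&& is_dart G (thead t), closes b (thead t) n (thead t)
      & tval t == traject (face_step b) (thead t) n.+1].
Proof.
case/tupleP: t => d t /=; rewrite theadE inE /closes /=.
apply/idP/idP.
  case/andP=> /andP[/and3P[/= /andP[-> _] _ _] lt].
  rewrite rcons_path => /andP[/fpathE E]; rewrite E last_traject size_tuple => clo.
  by rewrite eqxx andbT -{1}(size_tuple t) -E lt.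
case/and3P=> dd /andP[gt clo] /eqP[E].
have iter_inj m : injective (iter m (face_step b)).
  by elim: m => //= m IH x y /face_step_inj/IH.
have ut : uniq (d :: t).
  rewrite E -trajectS looping_uniq; apply/negP => /trajectP[i i_n].
  rewrite -{1}(subnK (ltnW i_n)) addnC iterD => /iter_inj loop.
  suff : d \in traject (face_step b) (face_step b d) n.
    by move/(allP gt); rewrite ltnn.
  apply/trajectP; exists (n - i).-1; first by rewrite prednK ?subn_gt0 ?leq_subr.
  by rewrite -iterSr prednK ?subn_gt0.
have fc : fcycle (face_step b) (d :: t).
  by rewrite /= E rcons_path fpath_traject last_traject.
have darts : all (is_dart G) (d :: t).
  rewrite /= dd E /=; elim: n (face_step b d) (face_step_dart b dd) {t gt clo E ut fc}.
    by [].
  by move=> n IH e de /=; rewrite de IH // face_step_dart.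
have fol : cycle (@follows T) (d :: t).
  move: fc; apply: (@sub_in_cycle _ (mem (d :: t))); last exact/allP.
  move=> e e' et _ /eqP <-; apply: face_step_follows => //.
  exact: (allP darts).
by apply/andP; split=> //; apply/andP; split; [apply/and3P | rewrite E].
Qed.

(** The double count of pairs of a circuit and of bits for which it is a face:
    circuits are represented by their rooted listings, which for fixed bits are
    determined by their first dart. *)
Lemma sum_weights (s : bool) n :
  ((\sum_(C in circuits G n.+1 | s ==> vertex_simple C) weight G C) * 2 ^+ #|T| =
   (\sum_(d | is_dart G d)
     #|[set b | closes b d n d & s ==> uniq (heads b n.+1 d)]|)%:R)%R.
Proof.
rewrite circuits_rooted big_mkcondr /= (big_imset _ (@shifts_inj _)) /= mulr_suml.
pose simple (t : n.+1.-tuple (T * T)) := s ==> uniq [seq d.1 | d <- tval t].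
transitivity (\sum_(t in rooted_circuits n.+1)
   (\sum_b (fcycle (face_step b) t && simple t))%:R : rat)%R.
  apply: eq_bigr => t; rewrite inE => /andP[ct _].
  rewrite vertex_simple_shifts -/(simple t); case: (simple t); last first.
    by rewrite mul0r big1 // => b _; rewrite andbF.
  rewrite weight_shifts //; congr (_%:R)%R; rewrite -sum1dep_card [LHS]big_mkcond.
  by apply: eq_bigr => b _; rewrite andbT; case: ifP.
rewrite -natr_sum exchange_big /=; congr (_%:R)%R.
transitivity (\sum_(d | is_dart G d) \sum_b
   (closes b d n d && (s ==> uniq (heads b n.+1 d)))); last first.
  apply: eq_bigr => d _; rewrite -sum1dep_card [RHS]big_mkcond /=.
  by apply: eq_bigr => b _; case: ifP.
rewrite [RHS]exchange_big /=; apply: eq_bigr => b _.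
pose face d : n.+1.-tuple (T * T) :=
  tcast (size_traject (face_step b) d n.+1)
    (in_tuple (traject (face_step b) d n.+1)).
have faceE d : tval (face d) = traject (face_step b) d n.+1 by rewrite val_tcast.
have thead_face d : thead (face d) = d.
  by rewrite /thead (tnth_nth d) faceE.
transitivity (\sum_(t in rooted_circuits n.+1 | fcycle (face_step b) t && simple t) 1).
  by rewrite [RHS]big_mkcondr; apply: eq_bigr => t _; case: ifP.
transitivity (\sum_(d | is_dart G d
    && (closes b d n d && (s ==> uniq (heads b n.+1 d)))) 1); last first.
  by rewrite [LHS]big_mkcondr; apply: eq_bigr => d _; case: ifP.
rewrite (reindex_onto face (@thead _ _)) => [|t]; last first.
  rewrite andbA rooted_faceP => /andP[/and3P[_ _ /eqP E] _].
  by apply: val_inj; rewrite /= faceE -E.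
apply: eq_bigl => d; rewrite thead_face eqxx andbT andbA.
have -> : (face d \in rooted_circuits n.+1) && fcycle (face_step b) (face d)
        = is_dart G d && closes b d n d.
  by rewrite rooted_faceP thead_face faceE eqxx andbT.
rewrite [RHS]andbA; apply: andb_id2l; case/andP=> _ /andP[_ clo].
congr (_ ==> _); rewrite /heads -faceE -(@fcycle_heads b).
  by rewrite map_rot rot_uniq.
by rewrite faceE /= rcons_path fpath_traject last_traject.
Qed.

End CubicRotations.

(** * Searching for faces *)

(** The search runs on natural numbers, so that it computes: a dart is a pair of
    numbers, [nb] lists the neighbours of each vertex in the order used by [turn],
    and [p] records the bits revealed so far. *)
Definition before (d e : nat * nat) : bool :=
  (d.1 < e.1) || (d.1 == e.1) && (d.2 < e.2).

Definition turn_code (nb : seq (seq nat)) (c : bool) (d : nat * nat) : nat * nat :=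
  (d.2, (if c then next else prev) (nth [::] nb d.2) d.1).

(** The weighted number of ways to reveal bits beyond [p] so that the walk from
    [d] first returns to [d0] after [n.+1] steps, without going through a dart
    smaller than [d0]; with [simple], moreover, only through vertices whose bit was
    unknown when they were reached, which excludes any repetition.
    A step through a vertex whose bit is known is doubled, so that each step
    carries a factor 2 in total, whether or not it reveals a bit. *)
Fixpoint search (nb : seq (seq nat)) (simple : bool) (d0 : nat * nat) (n : nat)
    (p : seq (option bool)) (d : nat * nat) : nat :=
  let visit c q :=
    let e := turn_code nb c d in
    if n is m.+1 then if before d0 e then search nb simple d0 m q e else 0
    else (e == d0 : nat) in
  if nth None p d.2 is Some c then if simple then 0 else (visit c p).*2
  else visit true (set_nth None p d.2 (Some true))
     + visit false (set_nth None p d.2 (Some false)).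

Definition count_faces (nb : seq (seq nat)) (simple : bool) (k : nat) : nat :=
  sumn [seq sumn [seq search nb simple (v, u) k.-1 [::] (v, u) | u <- nth [::] nb v]
       | v <- iota 0 (size nb)].

Section Search.

Variables (N : nat) (G : sgraph 'I_N).
Hypothesis cubic : forall v, #|nbrs G v| = 3.
Variable nb : seq (seq nat).
Hypothesis size_nb : size nb = N.
Hypothesis nbE : forall v : 'I_N, nth [::] nb v = [seq val u | u <- enum (nbrs G v)].

Notation dart := ('I_N * 'I_N)%type.

Definition dart_code (d : dart) : nat * nat := (val d.1, val d.2).

(** The lexicographic order [before] as a numbering of the darts. *)
Definition dart_key (d : dart) : nat := N * d.1 + d.2.

Lemma dart_key_lt (d e : dart) : d.1 < e.1 -> dart_key d < dart_key e.
Proof.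
move=> lt; rewrite /dart_key; apply: leq_trans (leq_addr _ _).
apply: (@leq_trans (N * d.1.+1)); first by rewrite mulnS addnC ltn_add2r.
by rewrite leq_mul2l lt orbT.
Qed.

Lemma before_dart_code d e :
  before (dart_code d) (dart_code e) = (dart_key d < dart_key e).
Proof.
rewrite /before /=; case: (ltngtP d.1 e.1) => [lt|gt|E] /=.
- by rewrite dart_key_lt.
- by apply/esym/negbTE; rewrite -leqNgt ltnW ?dart_key_lt.
- by rewrite /dart_key E ltn_add2l.
Qed.

Lemma dart_code_inj : injective dart_code.
Proof. by case=> u v [u' v'] [] /val_inj-> /val_inj->. Qed.

Lemma dart_key_inj : injective dart_key.
Proof.
move=> d e E; have := ltnn (dart_key d).
case: (ltngtP d.1 e.1) => [lt|gt|E1]; first by rewrite {2}E dart_key_lt.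
  by rewrite {1}E dart_key_lt.
move: E E1; case: d e => [u v] [u' v']; rewrite /dart_key /= => E E1 _.
move: E; rewrite E1 => /addnI/val_inj ->; congr (_, _); exact: val_inj.
Qed.

Lemma turn_codeE (b : {ffun 'I_N -> bool}) d :
  turn_code nb (b d.2) (dart_code d) = dart_code (face_step G b d).
Proof.
case: d => u v; rewrite /turn_code /dart_code /= nbE /turn.
by case: (b v); rewrite ?next_map ?prev_map ?enum_uniq //; exact: val_inj.
Qed.

Definition extending (p : seq (option bool)) : {set {ffun 'I_N -> bool}} :=
  extensions (fun v : 'I_N => nth None p v).

Lemma extending_set p (v : 'I_N) (b : {ffun 'I_N -> bool}) c : nth None p v = None ->
  (b \in extending (set_nth None p v (Some c))) = (b \in extending p) && (b v == c).
Proof.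
move=> pv; rewrite !inE; apply/forallP/andP => [H|[/forallP H /eqP bv] w].
  split; last by have := H v; rewrite nth_set_nth /= eqxx /= eq_sym.
  apply/forallP => w; have := H w; rewrite nth_set_nth /=.
  by case: (val w =P val v) => [/ord_inj -> _|_ //]; rewrite pv.
rewrite nth_set_nth /=; case: (val w =P val v) => [/ord_inj ->|_]; last exact: H.
by rewrite bv eqxx orbT.
Qed.

Lemma card_extending_set p (v : 'I_N) c : nth None p v = None ->
  #|extending p| = #|extending (set_nth None p v (Some c))|.*2.
Proof.
move=> pv; rewrite /extending !card_extensions.
rewrite (cardsD1 v) inE pv eqxx /= add1n expnS mul2n; congr (2 ^ _).*2.
apply: eq_card => w; rewrite !inE nth_set_nth /= val_eqE.
by case: (w == v).
Qed.

Definition fresh (p : seq (option bool)) (vs : seq 'I_N) : bool :=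
  all (fun v : 'I_N => nth None p v == None) vs && uniq vs.

Lemma fresh_cons p (v : 'I_N) c vs : nth None p v = None ->
  fresh p (v :: vs) = fresh (set_nth None p v (Some c)) vs.
Proof.
move=> pv; rewrite /fresh /= pv eqxx /= andbA; congr (_ && _).
rewrite -has_pred1 -all_predC -all_predI.
apply: eq_all => w; rewrite /= nth_set_nth /= val_eqE.
by case: (w == v); rewrite ?andbF ?andbT.
Qed.

(** What a branch of [search] contributes once the next dart [e] is known. *)
Definition visit simple d0 n q e :=
  if n is m.+1 then
    if before (dart_code d0) e then search nb simple (dart_code d0) m q e else 0
  else (e == dart_code d0 : nat).

Lemma searchE simple d0 n p d :
  search nb simple (dart_code d0) n p (dart_code d)
  = if nth None p d.2 is Some c then
      if simple then 0 else (visit simple d0 n p (turn_code nb c (dart_code d))).*2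
    else visit simple d0 n (set_nth None p d.2 (Some true))
           (turn_code nb true (dart_code d))
       + visit simple d0 n (set_nth None p d.2 (Some false))
           (turn_code nb false (dart_code d)).
Proof. by case: n. Qed.

Lemma closesS b d0 n d : closes G dart_key b d0 n.+1 d
  = (dart_key d0 < dart_key (face_step G b d))
    && closes G dart_key b d0 n (face_step G b d).
Proof. by rewrite /closes iterSr -andbA. Qed.

(** Once the bit of the head of [d] is part of [q], all extensions of [q] take the
    same step from [d], and the count is that of the walk from the next dart. *)
Lemma visit_correct (simple : bool) d0 n q (d : dart) c :
  (forall b, b \in extending q -> b d.2 = c) ->
  (forall m e, n = m.+1 -> #|[set b in extending q | closes G dart_key b d0 m e
       & simple ==> fresh q (heads G b n e)]| * 2 ^ n
     = #|extending q| * search nb simple (dart_code d0) m q (dart_code e)) ->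
  #|[set b in extending q | closes G dart_key b d0 n d
       & simple ==> fresh q (heads G b n (face_step G b d))]| * 2 ^ n
  = #|extending q| * visit simple d0 n q (turn_code nb c (dart_code d)).
Proof.
move=> bc IH; pose e : dart := (d.2, turn G c d.2 d.1).
have stepE b : b \in extending q -> face_step G b d = e.
  by rewrite /face_step => /bc ->.
have -> : turn_code nb c (dart_code d) = dart_code e.
  by rewrite -(ffunE (fun=> c) d.2) turn_codeE /face_step ffunE.
case: n IH => [|n] IH.
  rewrite muln1 /visit (inj_eq dart_code_inj).
  case: eqP => Ee; last first.
    rewrite muln0; apply: eq_card0 => b; rewrite [LHS]inE.
    by apply/negP => /andP[/stepE sb]; rewrite /closes /= sb => /andP[/eqP].
  rewrite muln1; apply: eq_card => b; rewrite [LHS]inE.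
  case bq: (b \in extending q) => //=.
  by rewrite /closes /= stepE // Ee eqxx /fresh /= implybT.
rewrite /visit before_dart_code; case: ifP => lt; last first.
  rewrite muln0; apply/eqP; rewrite muln_eq0; apply/orP; left; apply/eqP.
  apply: eq_card0 => b; rewrite [LHS]inE.
  by apply/negP => /andP[/stepE sb]; rewrite closesS sb lt.
rewrite -IH //; congr (_ * _); apply: eq_card => b; rewrite [LHS]inE [RHS]inE.
by apply: andb_id2l => /stepE sb; rewrite closesS sb lt.
Qed.

(** The search computes a conditional probability, scaled by [2 ^ n.+1]: the
    proportion, among the assignments that extend [p], of those for which the walk
    from [d] closes at [d0].  If the bit at the head of [d] is known there is
    nothing to split and the new factor 2 is the doubling in [search]; otherwise
    the two values of the bit share the assignments equally, and this halving
    absorbs the factor. *)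
Lemma search_correct simple d0 n p d :
  #|[set b in extending p | closes G dart_key b d0 n d
       & simple ==> fresh p (heads G b n.+1 d)]| * 2 ^ n.+1
  = #|extending p| * search nb simple (dart_code d0) n p (dart_code d).
Proof.
elim/ltn_ind: n p d => n IHn p d.
have V q c : (forall b, b \in extending q -> b d.2 = c) ->
  #|[set b in extending q | closes G dart_key b d0 n d
       & simple ==> fresh q (heads G b n (face_step G b d))]| * 2 ^ n
  = #|extending q| * visit simple d0 n q (turn_code nb c (dart_code d)).
  by move=> qc; apply: visit_correct => // m e En; rewrite En IHn ?En.
rewrite searchE; case pv: (nth None p d.2) => [c|].
  have pc b : b \in extending p -> b d.2 = c.
    by rewrite inE => /forallP/(_ d.2); rewrite pv => /eqP[].
  case: ifP => s; rewrite s in V *.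
    rewrite muln0; apply/eqP; rewrite muln_eq0; apply/orP; left; apply/eqP.
    by apply: eq_card0 => b; rewrite inE /fresh /= pv !andbF.
  by rewrite expnS mulnCA -mul2n [RHS]mulnCA -V.
have split_card c := card_extending_set c pv.
have half c : #|[set b in extending (set_nth None p d.2 (Some c)) |
       closes G dart_key b d0 n d & simple ==> fresh p (heads G b n.+1 d)]| * 2 ^ n.+1
    = #|extending p| * visit simple d0 n (set_nth None p d.2 (Some c))
                         (turn_code nb c (dart_code d)).
  rewrite (split_card c) -mul2n -mulnA -V => [|b]; last first.
    by rewrite extending_set // => /andP[_ /eqP].
  rewrite expnS mulnCA; congr (_ * (_ * _)); apply: eq_card => b; rewrite !inE.
  by rewrite -(fresh_cons c).
rewrite mulnDr -!half -mulnDl; congr (_ * _).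
have mem_filter q b Q :
  (b \in [set b in extending q | Q b]) = (b \in extending q) && Q b.
  by rewrite [LHS]inE.
rewrite -(cardsID [set b : {ffun 'I_N -> bool} | b d.2 == true]); congr (_ + _).
  apply: eq_card => b; rewrite in_setI mem_filter inE mem_filter extending_set //.
  by rewrite andbAC.
apply: eq_card => b; rewrite in_setD mem_filter inE mem_filter extending_set //.
by rewrite -andbA andbCA eqb_id eqbF_neg.
Qed.

Lemma count_faces_correct simple k : 0 < k ->
  ((\sum_(C in circuits G k | simple ==> vertex_simple C) weight G C) * 2 ^+ k
   = (count_faces nb simple k)%:R)%R.
Proof.
case: k => // n _.
apply: (@mulIf _ (2 ^+ N)%R); first by rewrite expf_neq0 // pnatr_eq0.
have := sum_weights cubic dart_key_inj simple n; rewrite card_ord mulrAC => ->.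
rewrite -!natrX -!natrM.
congr (_%:R)%R; rewrite big_distrl /=.
have ext0 : extending [::] = setT.
  by apply/setP => b; rewrite !inE; apply/forallP => v; rewrite nth_nil.
have fresh0 vs : fresh [::] vs = uniq vs.
  by rewrite /fresh (eq_all (a2 := predT)) ?all_predT // => v; rewrite nth_nil.
pose found d := search nb simple (dart_code d) n [::] (dart_code d).
transitivity (\sum_(d | is_dart G d) 2 ^ N * found d).
  apply: eq_bigr => d _; have := search_correct simple d n [::] d.
  rewrite ext0 cardsT card_ffun card_bool card_ord => <-; congr (_ * _).
  by apply: eq_card => b; rewrite !inE fresh0.
rewrite -big_distrr mulnC /=; congr (_ * _).
rewrite /count_faces /= sumnE big_map size_nb -val_enum_ord big_map big_enum /=.
rewrite (eq_bigr (fun v : 'I_N => \sum_(u | G v u) found (v, u))).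
  by rewrite pair_big_dep /=; apply: eq_big => [] [].
move=> v _; rewrite sumnE big_map nbE big_map big_enum /=.
by apply: eq_bigl => u; rewrite inE.
Qed.

End Search.

(** * The six graphs *)

Definition neighbour_table (E : seq (nat * nat)) : seq (seq nat) :=
  [seq [seq u <- iota 0 22 | ((v, u) \in E) || ((u, v) \in E)] | v <- iota 0 22].

Definition graph_edges : seq (seq (nat * nat)) :=
  [:: W1_edges; W2_edges; W3_edges; W4_edges; W5_edges; W6_edges].

Lemma W_edges_mem i : W_edges i \in graph_edges.
Proof. exact: mem_nth. Qed.

Lemma neighbour_tableE i (v : 'I_22) :
  nth [::] (neighbour_table (W_edges i)) v = [seq val u | u <- enum (nbrs (W i) v)].
Proof.
rewrite (nth_map 0) ?size_iota // nth_iota // add0n -[iota 0 22]val_enum_ord.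
rewrite filter_map enumT; congr map; rewrite [RHS]/enum_mem.
by apply: eq_filter => u; rewrite /= inE.
Qed.

Lemma weight_sum_W (i : 'I_6) simple k : 0 < k ->
  ((\sum_(C in circuits (W i) k | simple ==> vertex_simple C) weight (W i) C) * 2 ^+ k
   = (count_faces (neighbour_table (W_edges i)) simple k)%:R)%R.
Proof.
apply: (count_faces_correct (@W_cubic i)); first by rewrite size_map size_iota.
exact: neighbour_tableE.
Qed.

Lemma A_W (i : 'I_6) k : 0 < k ->
  A (W i) k = ((count_faces (neighbour_table (W_edges i)) false k)%:R / 2 ^+ k)%R.
Proof.
move=> k0; rewrite -weight_sum_W // mulfK ?expf_neq0 ?pnatr_eq0 //.
by apply: eq_bigl => C; rewrite andbT.
Qed.

Lemma A_cyc_W (i : 'I_6) k : 0 < k ->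
  A_cyc (W i) k = ((count_faces (neighbour_table (W_edges i)) true k)%:R / 2 ^+ k)%R.
Proof. by move=> k0; rewrite -weight_sum_W // mulfK ?expf_neq0 ?pnatr_eq0. Qed.

(** The [k]-th entry is [2 ^ k * A k], for [k] from 1 to 11. *)
Lemma count_faces_upto11 : all (fun E =>
    [seq count_faces (neighbour_table E) false k | k <- iota 1 11]
      == [:: 0; 0; 2; 2; 6; 24; 14; 34; 30; 96; 182]) graph_edges.
Proof. by vm_compute. Qed.

Lemma count_faces_W1_12 :
  count_faces (neighbour_table (W_edges ord0)) false 12 = 270.
Proof. by vm_compute. Qed.

Lemma count_faces_W2_12 :
  count_faces (neighbour_table (W_edges (lift ord0 ord0))) false 12 = 302.
Proof. by vm_compute. Qed.

Lemma count_simple_faces_12 :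
  all (fun E => count_faces (neighbour_table E) true 12 == 174) graph_edges.
Proof. by vm_compute. Qed.

Lemma A_W_common i j k : 0 < k <= 11 -> A (W i) k = A (W j) k.
Proof.
case/andP=> k0 k11; rewrite !A_W //; congr (_%:R / _)%R.
(* Stated for an arbitrary [f], so that no count is evaluated here. *)
have count_nth (f : nat -> nat) (counts : seq nat) :
    [seq f l | l <- iota 1 11] == counts -> f k = nth 0 counts k.-1.
  move/eqP <-; rewrite (nth_map 0) ?size_iota ?prednK //.
  by rewrite nth_iota ?prednK // add1n prednK.
have countE l := count_nth _ _ (allP count_faces_upto11 _ (W_edges_mem l)).
by rewrite (countE i) (countE j).
Qed.

Local Open Scope ring_scope.

Theorem theorem12p4 :
  (forall (k : nat), (3 <= k <= 11)%N ->
     forall i j : 'I_6, A (W i) k = A (W j) k) /\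
  ((exists i j : 'I_6, A (W i) 12 <> A (W j) 12) /\
   (forall k : nat, (0 < k)%N ->
      (exists i j : 'I_6, A (W i) k <> A (W j) k) -> (12 <= k)%N)) /\
  (forall i : 'I_6, A_cyc (W i) 12 = 87 / 2048) /\
  (forall i j : 'I_6,
     A (W i) 12 - A (W j) 12 = A_nonsimp (W i) 12 - A_nonsimp (W j) 12).
Proof.
have cyc12 i : A_cyc (W i) 12 = 87 / 2048.
  rewrite (A_cyc_W i (isT : (0 < 12)%N)).
  have /eqP -> := allP count_simple_faces_12 _ (W_edges_mem i).
  have -> : 2048 = 2 ^+ 11 :> rat by apply/eqP; rewrite -natrX eqr_nat.
  have -> : 174 = 87 * 2 :> rat by rewrite -natrM.
  by rewrite exprSr -mulf_div divff ?mulr1.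
have A1 := A_W ord0 (isT : (0 < 12)%N).
have A2 := A_W (lift ord0 ord0) (isT : (0 < 12)%N).
rewrite count_faces_W1_12 in A1; rewrite count_faces_W2_12 in A2.
split; [|split; [split|split]].
- by move=> k /andP[k3 k11] i j; apply: A_W_common; rewrite k11 (ltn_trans _ k3).
- exists ord0, (lift ord0 ord0); rewrite A1 A2.
  have nz : (2 ^+ 12)^-1 != 0 :> rat by rewrite invr_eq0 expf_neq0.
  by move/(mulIf nz)/eqP; rewrite eqr_nat.
- move=> k k0 [i [j ne]]; rewrite ltnNge; apply/negP => k11.
  by apply/ne/A_W_common; rewrite k0.
- exact: cyc12.
- move=> i j; rewrite (A_split (W i)) (A_split (W j)) (cyc12 i) (cyc12 j).
  by move: (_ / _) => c; rewrite opprD addrACA subrr add0r.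
Qed.
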